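(* Let $f,g:[a,b]\to\mathbb{R}$ be such that $f$ is of bounded variation on $[a,b]$ and $g$ is monotonic nondecreasing on $[a,b]$. Then $$\left|\mathcal{T}_a^v(f,g)-\mathcal{T}_u^b(f,g)\right|\le\frac14\left\{\frac{[g(v)-g(a)]+[g(b)-g(u)]}{2}+\left|\frac{g(v)+g(u)}{2}-\frac{g(a)+g(b)}{2}\right|\right\}\cdot\bigvee_a^b(f)$$ for all $a\le u<v\le b$.
   Context: For real numbers $\alpha<\beta$ and functions $f,g$ on $[\alpha,\beta]$ (with the integrals existing), the Čebyšev functional is $$\mathcal{T}_\alpha^\beta(f,g)=\frac{1}{\beta-\alpha}\int_\alpha^\beta f(t)g(t)\,dt-\frac{1}{\beta-\alpha}\int_\alpha^\beta f(t)\,dt\cdot\frac{1}{\beta-\alpha}\int_\alpha^\beta g(t)\,dt.$$ $\bigvee_a^b(f)$ denotes the total variation of $f$ on $[a,b]$. *)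

(* Defs.v *)
From mathcomp Require Import all_boot all_order all_algebra.
From mathcomp Require Import all_classical all_reals all_analysis.
Set Implicit Arguments.
Unset Strict Implicit.
Unset Printing Implicit Defensive.
Import Order.TTheory GRing.Theory Num.Theory.
Import numFieldNormedType.Exports.
Local Open Scope classical_set_scope.
Local Open Scope ring_scope.

(* A function on [alpha, beta] is represented by a total function R -> R; only
   its values on [alpha, beta] matter.  The integral is the real-valued Lebesgue
   integral, which coincides with the Riemann integral of every
   Riemann-integrable function, in particular of functions of bounded
   variation, monotone functions and their products. *)
Definition mean (R : realType) (alpha beta : R) (f : R -> R) : R :=
  (beta - alpha)^-1 *
  \int[@lebesgue_measure R]_(t in `[alpha, beta]) f t.

Definition cebysev (R : realType) (alpha beta : R) (f g : R -> R) : R :=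
  mean alpha beta (fun t => f t * g t) -
  mean alpha beta f * mean alpha beta g.

(* Main.v *)
Require Import Defs.
From mathcomp Require Import all_boot all_order all_algebra.
From mathcomp Require Import all_classical all_reals all_analysis.
From mathcomp Require Import measurable_realfun ring lra.
Import Order.TTheory GRing.Theory Num.Theory.
Import numFieldNormedType.Exports.
Local Open Scope classical_set_scope.
Local Open Scope ring_scope.

(** The bracket on the right-hand side is the larger of the two increments
    g v - g a and g b - g u; call it M.

    Bounding the two functionals separately and adding up would count the
    variation of f on [u, v] twice.  The gain comes from sign information: for
    nondecreasing f and g the functional is nonnegative (Chebyshev's inequality,
    [cebysev_ge0]) and at most a quarter of the product of the increments of f
    and g (Gruss' inequality, [cebysev_gruss]).  Two numbers of [0, K] differ by
    at most K, so for nondecreasing f the difference of the two functionals is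
    at most M (f b - f a) / 4 in absolute value
    ([cebysev_diff_nondecreasing]).

    A function of bounded variation is a difference p - n of nondecreasing
    functions whose increments over [a, b] add up to its total variation
    ([bounded_variation_jordan]).  The functional is linear in f, so the bounds
    for p and n add up to the claim.

    Both inequalities come from expanding the mean of a product
    (f - c) (g - d) for constants c and d ([mean_mulBB]). *)

(** * Bounded measurable functions on a segment *)

(** On a segment these functions are integrable, and unlike the integrable ones
    they are closed under products, as the functional requires. *)
Definition bounded_measurable {R : realType} (alpha beta : R) (f : R -> R) :=
  measurable_fun `[alpha, beta] f /\
  exists M, {in `[alpha, beta], forall t, `|f t| <= M}.

Lemma bounded_measurable_integrable {R : realType} (alpha beta : R)
    (f : R -> R) :
  bounded_measurable alpha beta f ->
  (@lebesgue_measure R).-integrable `[alpha, beta] (EFin \o f).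
Proof.
move=> [mf [M fM]]; apply: measurable_bounded_integrable => //=.
  by rewrite lebesgue_measure_itv /=; case: ifP => _; rewrite ?ltry.
exists M; split; first exact: num_real.
by move=> N MN t tab; apply: le_trans (ltW MN); apply: fM.
Qed.

Lemma bounded_measurable_cst {R : realType} (alpha beta c : R) :
  bounded_measurable alpha beta (fun=> c).
Proof. by split; [exact: measurable_cst | exists `|c|]. Qed.

Lemma bounded_measurableD {R : realType} (alpha beta : R) (f g : R -> R) :
  bounded_measurable alpha beta f -> bounded_measurable alpha beta g ->
  bounded_measurable alpha beta (fun t => f t + g t).
Proof.
move=> [mf [M fM]] [mg [N gN]]; split; first exact: measurable_funD.
exists (M + N) => t tab; apply: le_trans (ler_normD _ _) _.
by rewrite lerD ?fM ?gN.
Qed.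

Lemma bounded_measurableM {R : realType} (alpha beta : R) (f g : R -> R) :
  bounded_measurable alpha beta f -> bounded_measurable alpha beta g ->
  bounded_measurable alpha beta (fun t => f t * g t).
Proof.
move=> [mf [M fM]] [mg [N gN]]; split; first exact: measurable_funM.
by exists (M * N) => t tab; rewrite normrM ler_pM ?fM ?gN.
Qed.

Lemma bounded_measurableB {R : realType} (alpha beta : R) (f g : R -> R) :
  bounded_measurable alpha beta f -> bounded_measurable alpha beta g ->
  bounded_measurable alpha beta (fun t => f t - g t).
Proof.
move=> [mf [M fM]] [mg [N gN]]; split; first exact: measurable_funB.
exists (M + N) => t tab; apply: le_trans (ler_normB _ _) _.
by rewrite lerD ?fM ?gN.
Qed.

(** Clamping the argument to the segment extends the function to one that is
    nondecreasing on the whole line, hence measurable. *)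
Lemma nondecreasing_bounded_measurable {R : realType} (alpha beta : R)
    (f : R -> R) :
  alpha <= beta ->
  {in `[alpha, beta] &, {homo f : x y / x <= y}} ->
  bounded_measurable alpha beta f.
Proof.
move=> ab f_nd.
have aI : alpha \in `[alpha, beta] by rewrite in_itv/= lexx ab.
have bI : beta \in `[alpha, beta] by rewrite in_itv/= lexx ab.
split.
  pose clamp (t : R) := Num.max alpha (Num.min beta t).
  have clampI t : clamp t \in `[alpha, beta].
    by rewrite in_itv/= /clamp le_max lexx /= ge_max ab ge_min lexx.
  apply: (@eq_measurable_fun _ _ _ _ _ (f \o clamp)).
    move=> t; rewrite inE/= in_itv/= => /andP[at_ tb].
    by rewrite /clamp (min_idPr tb) (max_idPr at_).
  apply: nondecreasing_measurable => // s t st /=.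
  apply: f_nd => //; rewrite /clamp.
  by rewrite ge_max le_max lexx/= le_max le_min !ge_min lexx st orbT orbT.
exists (`|f alpha| + `|f beta|) => t tI.
have /andP[at_ tb] : alpha <= t <= beta by move: tI; rewrite in_itv.
have := f_nd _ _ aI tI at_; have := f_nd _ _ tI bI tb.
have := ler_norm (f beta); have := ler_norm (- f alpha).
rewrite normrN => ? ? ? ?.
have := normr_ge0 (f alpha); have := normr_ge0 (f beta) => ? ?.
by rewrite ler_norml; apply/andP; split; lra.
Qed.

(** * The integral mean *)

Lemma eq_mean {R : realType} (alpha beta : R) (f g : R -> R) :
  {in `[alpha, beta], f =1 g} -> mean alpha beta f = mean alpha beta g.
Proof.
move=> fg; rewrite /mean; congr (_ * _); apply: eq_Rintegral => t.
by rewrite inE => tI; apply: fg.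
Qed.

Lemma mean_cst {R : realType} (alpha beta c : R) : alpha < beta ->
  mean alpha beta (fun=> c) = c.
Proof.
move=> ab; rewrite /mean Rintegral_cst//= lebesgue_measure_itv/= lte_fin ab/=.
by rewrite mulrC mulfK// gt_eqF// subr_gt0.
Qed.

Lemma meanD {R : realType} (alpha beta : R) (f g : R -> R) :
  bounded_measurable alpha beta f -> bounded_measurable alpha beta g ->
  mean alpha beta (fun t => f t + g t) = mean alpha beta f + mean alpha beta g.
Proof.
move=> bf bg.
by rewrite /mean RintegralD ?mulrDr//; exact: bounded_measurable_integrable.
Qed.

Lemma meanB {R : realType} (alpha beta : R) (f g : R -> R) :
  bounded_measurable alpha beta f -> bounded_measurable alpha beta g ->
  mean alpha beta (fun t => f t - g t) = mean alpha beta f - mean alpha beta g.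
Proof.
move=> bf bg.
by rewrite /mean RintegralB ?mulrBr//; exact: bounded_measurable_integrable.
Qed.

Lemma meanZ {R : realType} (alpha beta c : R) (f : R -> R) :
  bounded_measurable alpha beta f ->
  mean alpha beta (fun t => c * f t) = c * mean alpha beta f.
Proof.
move=> bf.
by rewrite /mean RintegralZl 1?mulrCA//; exact: bounded_measurable_integrable.
Qed.

Lemma le_mean {R : realType} (alpha beta : R) (f g : R -> R) : alpha < beta ->
  bounded_measurable alpha beta f -> bounded_measurable alpha beta g ->
  {in `[alpha, beta], forall t, f t <= g t} ->
  mean alpha beta f <= mean alpha beta g.
Proof.
move=> ab bf bg fg; apply: ler_wpM2l; first by rewrite invr_ge0 subr_ge0 ltW.
by apply: le_Rintegral => //; exact: bounded_measurable_integrable.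
Qed.

Lemma mean_mulBB {R : realType} (alpha beta c d : R) (f g : R -> R) :
  alpha < beta ->
  bounded_measurable alpha beta f -> bounded_measurable alpha beta g ->
  mean alpha beta (fun t => (f t - c) * (g t - d)) =
  mean alpha beta (fun t => f t * g t) - c * mean alpha beta g
    - d * mean alpha beta f + c * d.
Proof.
move=> ab bf bg; have bc k := bounded_measurable_cst alpha beta k.
have bfg := bounded_measurableM _ _ _ _ bf bg.
have bcg := bounded_measurableM _ _ _ _ (bc c) bg.
have bdf := bounded_measurableM _ _ _ _ (bc d) bf.
have bfgc := bounded_measurableB _ _ _ _ bfg bcg.
have bfgcd := bounded_measurableB _ _ _ _ bfgc bdf.
rewrite -(mean_cst _ _ (c * d) ab) -!meanZ// -!meanB// -meanD//.
by apply: eq_mean => t _; ring.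
Qed.

(** * The functional on monotone functions *)

Lemma cebysevB {R : realType} (alpha beta : R) (f1 f2 g : R -> R) :
  bounded_measurable alpha beta f1 -> bounded_measurable alpha beta f2 ->
  bounded_measurable alpha beta g ->
  cebysev alpha beta (fun t => f1 t - f2 t) g =
  cebysev alpha beta f1 g - cebysev alpha beta f2 g.
Proof.
move=> b1 b2 bg; rewrite /cebysev meanB//.
rewrite (eq_mean _ _ _ (fun t => f1 t * g t - f2 t * g t)).
  by rewrite meanB; [ring | exact: bounded_measurableM..].
by move=> t _; rewrite mulrBl.
Qed.

(** Chebyshev's inequality.  The product (f s - f t) * (g s - g t) is
    nonnegative for all s and t; averaging it over s and then over t yields
    twice the functional.  Both averages are over one variable, so linearity of
    the mean replaces a double integral. *)
Lemma cebysev_ge0 {R : realType} (alpha beta : R) (f g : R -> R) :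
  alpha < beta ->
  {in `[alpha, beta] &, {homo f : x y / x <= y}} ->
  {in `[alpha, beta] &, {homo g : x y / x <= y}} ->
  0 <= cebysev alpha beta f g.
Proof.
move=> ab f_nd g_nd.
have bf := nondecreasing_bounded_measurable _ _ _ (ltW ab) f_nd.
have bg := nondecreasing_bounded_measurable _ _ _ (ltW ab) g_nd.
have bc k := bounded_measurable_cst alpha beta k.
set m := mean alpha beta.
pose h t := (f t - m f) * (g t - m g).
have bh : bounded_measurable alpha beta h.
  by apply: bounded_measurableM; exact: bounded_measurableB.
have mh : m h = cebysev alpha beta f g.
  by rewrite /m mean_mulBB// /cebysev -/m; ring.
have h_ge0 : {in `[alpha, beta], forall t, 0 <= h t + cebysev alpha beta f g}.
  move=> t tI.
  have -> : h t + cebysev alpha beta f g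
          = m (fun s => (f s - f t) * (g s - g t)).
    by rewrite /m mean_mulBB// /cebysev -/m /h; ring.
  rewrite -(mean_cst _ _ 0 ab); apply: le_mean => //.
    by apply: bounded_measurableM; exact: bounded_measurableB.
  move=> s sI; have [st|/ltW ts] := leP s t.
    by rewrite mulr_le0// subr_le0; [exact: f_nd|exact: g_nd].
  by rewrite mulr_ge0// subr_ge0; [exact: f_nd|exact: g_nd].
have : 0 <= m (fun t => h t + cebysev alpha beta f g).
  rewrite -(mean_cst _ _ 0 ab); apply: le_mean => //.
  exact: bounded_measurableD.
rewrite /m meanD// mean_cst// -/m mh; lra.
Qed.

Lemma le_mul_mean {R : realFieldType} (A B C D T : R) :
  0 <= A -> 0 <= B -> 0 <= C -> 0 <= D -> T <= A * C -> T <= B * D ->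
  T <= 1 / 4 * (A + B) * (C + D).
Proof.
move=> A0 B0 C0 D0 TAC TBD.
have AD0 : 0 <= A * D by exact: mulr_ge0.
have BC0 : 0 <= B * C by exact: mulr_ge0.
suff : 2 * T <= A * D + B * C by lra.
have [T0|T0] := leP T 0; first by lra.
have TT : T * T <= (A * D) * (B * C).
  have -> : (A * D) * (B * C) = (A * C) * (B * D) by ring.
  by rewrite ler_pM// ltW.
have AMGM : 4 * ((A * D) * (B * C)) <= (A * D + B * C) ^+ 2.
  rewrite -subr_ge0.
  have -> : (A * D + B * C) ^+ 2 - 4 * ((A * D) * (B * C))
          = (A * D - B * C) ^+ 2 by ring.
  exact: sqr_ge0.
(* The squares compare: (2 T)^2 <= 4 (A D) (B C) <= (A D + B C)^2. *)
rewrite -ler_sqr ?nnegrE; [|lra..].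
by apply: le_trans AMGM; rewrite expr2; lra.
Qed.

(** Since (f - F) * (g - gamma) and (f - phi) * (g - G) have nonpositive mean,
    the functional is at most A * C and at most B * D, where A and B are the
    distances of the mean of f to F and phi, and C and D those of the mean of
    g to gamma and G.  By the arithmetic-geometric inequality
    min (A * C) (B * D) <= (A + B) * (C + D) / 4. *)
Lemma cebysev_gruss {R : realType} (alpha beta phi F gamma G : R)
    (f g : R -> R) : alpha < beta ->
  bounded_measurable alpha beta f -> bounded_measurable alpha beta g ->
  {in `[alpha, beta], forall t, phi <= f t <= F} ->
  {in `[alpha, beta], forall t, gamma <= g t <= G} ->
  cebysev alpha beta f g <= 1 / 4 * (F - phi) * (G - gamma).
Proof.
move=> ab bf bg fI gI.
have bc k := bounded_measurable_cst alpha beta k.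
set m := mean alpha beta.
have le_m h k c : bounded_measurable alpha beta h -> k = m h ->
    {in `[alpha, beta], forall t, h t <= c} -> k <= c.
  by move=> bh -> hc; rewrite -(mean_cst _ _ c ab); exact: le_mean.
have ge_m h c : bounded_measurable alpha beta h ->
    {in `[alpha, beta], forall t, c <= h t} -> c <= m h.
  by move=> bh hc; rewrite -(mean_cst _ _ c ab); exact: le_mean.
have fF : m f <= F by apply: (le_m f) => // t /fI /andP[].
have phif : phi <= m f by apply: ge_m => // t /fI /andP[].
have gG : m g <= G by apply: (le_m g) => // t /gI /andP[].
have gammag : gamma <= m g by apply: ge_m => // t /gI /andP[].
have TAC : cebysev alpha beta f g <= (F - m f) * (m g - gamma).
  suff : cebysev alpha beta f g - (F - m f) * (m g - gamma) <= 0 by lra.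
  apply: (le_m (fun t => (f t - F) * (g t - gamma))).
  - by apply: bounded_measurableM; exact: bounded_measurableB.
  - by rewrite /m mean_mulBB// /cebysev -/m; ring.
  - move=> t tI; have /andP[_ ?] := fI t tI; have /andP[? _] := gI t tI.
    by rewrite mulr_le0_ge0// ?subr_le0 ?subr_ge0.
have TBD : cebysev alpha beta f g <= (m f - phi) * (G - m g).
  suff : cebysev alpha beta f g - (m f - phi) * (G - m g) <= 0 by lra.
  apply: (le_m (fun t => (f t - phi) * (g t - G))).
  - by apply: bounded_measurableM; exact: bounded_measurableB.
  - by rewrite /m mean_mulBB// /cebysev -/m; ring.
  - move=> t tI; have /andP[? _] := fI t tI; have /andP[_ ?] := gI t tI.
    by rewrite mulr_ge0_le0// ?subr_le0 ?subr_ge0.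
have := le_mul_mean (F - m f) (m f - phi) (m g - gamma) (G - m g) _.
rewrite !subr_ge0 => /(_ _ fF phif gammag gG TAC TBD).
by congr (_ <= _); ring.
Qed.

Lemma sub_itv {R : realType} (a b alpha beta : R) :
  a <= alpha -> beta <= b -> {subset `[alpha, beta] <= `[a, b]}.
Proof.
move=> aal bb t; rewrite !in_itv/= => /andP[? ?].
by rewrite (le_trans aal)// (le_trans _ bb).
Qed.

(** The increment of f is taken over the larger segment [a, b] so that
    functionals over different subsegments get bounds with a common factor. *)
Lemma cebysev_itv {R : realType} (a b alpha beta : R) (f g : R -> R) :
  a <= alpha -> alpha < beta -> beta <= b ->
  {in `[a, b] &, {homo f : x y / x <= y}} ->
  {in `[a, b] &, {homo g : x y / x <= y}} ->
  0 <= cebysev alpha beta f g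
    <= 1 / 4 * (g beta - g alpha) * (f b - f a).
Proof.
move=> aal ab bb f_nd g_nd.
have sub := sub_itv _ _ _ _ aal bb.
have homoS (h : R -> R) : {in `[a, b] &, {homo h : x y / x <= y}} ->
    {in `[alpha, beta] &, {homo h : x y / x <= y}}.
  by move=> h_nd x y /sub xI /sub yI; exact: h_nd.
have alI : alpha \in `[alpha, beta] by rewrite in_itv/= lexx ltW.
have beI : beta \in `[alpha, beta] by rewrite in_itv/= lexx ltW.
have a_b : a <= b by rewrite (le_trans aal)// (le_trans (ltW ab)).
have aI : a \in `[a, b] by rewrite in_itv/= lexx.
have bI : b \in `[a, b] by rewrite in_itv/= lexx andbT.
apply/andP; split; first by apply: cebysev_ge0; [|exact: homoS..].
rewrite mulrAC; apply: cebysev_gruss => //.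
- exact/(nondecreasing_bounded_measurable _ _ _ (ltW ab))/homoS.
- exact/(nondecreasing_bounded_measurable _ _ _ (ltW ab))/homoS.
- move=> t /sub tI; have := tI; rewrite in_itv/= => /andP[at_ tb].
  by rewrite !f_nd.
- move=> t tI; have := tI; rewrite in_itv/= => /andP[at_ tb].
  by rewrite !(homoS g).
Qed.

(** Both functionals are nonnegative, so their difference is bounded by the
    larger of the two rather than by their sum. *)
Lemma cebysev_diff_nondecreasing {R : realType} (a b u v M : R)
    (f g : R -> R) : a <= u -> u < v -> v <= b ->
  g v - g a <= M -> g b - g u <= M ->
  {in `[a, b] &, {homo f : x y / x <= y}} ->
  {in `[a, b] &, {homo g : x y / x <= y}} ->
  `|cebysev a v f g - cebysev u b f g| <= 1 / 4 * M * (f b - f a).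
Proof.
move=> au uv vb gM1 gM2 f_nd g_nd.
have av := le_lt_trans au uv; have ub := lt_le_trans uv vb.
have /andP[T1_ge0 T1_le] := cebysev_itv a b a v f g (lexx a) av vb f_nd g_nd.
have /andP[T2_ge0 T2_le] := cebysev_itv a b u b f g au ub (lexx b) f_nd g_nd.
have df : 0 <= f b - f a.
  by rewrite subr_ge0 f_nd ?in_itv/= ?lexx ?andbT ?(ltW (lt_le_trans av vb)).
have le_M x : x <= M -> 1 / 4 * x * (f b - f a) <= 1 / 4 * M * (f b - f a).
  by move=> xM; rewrite ler_wpM2r// ler_wpM2l// divr_ge0.
have := le_M _ gM1; have := le_M _ gM2.
by rewrite ler_norml => ? ?; apply/andP; split; lra.
Qed.

(** * Functions of bounded variation *)

(** The parts at t are (V t + f t) / 2 and (V t - f t) / 2, where V t is the total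
    variation of f on [a, t]; f cancels in their sum, so their increments add up
    to V b - V a. *)
Lemma bounded_variation_jordan {R : realType} (a b : R) (f : R -> R) :
  a <= b -> bounded_variation a b f ->
  exists p n : R -> R,
    [/\ {in `[a, b] &, {homo p : x y / x <= y}},
        {in `[a, b] &, {homo n : x y / x <= y}},
        {in `[a, b], forall t, f t = p t - n t} &
        (p b - p a) + (n b - n a) = fine (total_variation a b f)].
Proof.
move=> ab f_bv; exists (fine \o pos_tv a f), (fine \o neg_tv a f); split.
- exact/fine_neg_tv_nondecreasing/bounded_variationN.
- exact: fine_neg_tv_nondecreasing.
- exact: bounded_variation_pos_neg_tvE.
rewrite /pos_tv /neg_tv /= !total_variationN !total_variationxx.
have /fineK <- : total_variation a b f \is a fin_num by exact/bounded_variationP.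
by rewrite /=; lra.
Qed.

(** * The difference of the functionals over overlapping segments *)

Theorem theorem6 (R : realType) (a b : R) (f g : R -> R)
    (f_bv : bounded_variation a b f)
    (g_nd : {in `[a, b] &, {homo g : x y / x <= y}})
    (u v : R) (au : a <= u) (uv : u < v) (vb : v <= b) :
  `| cebysev a v f g - cebysev u b f g | <=
    1 / 4 * (((g v - g a) + (g b - g u)) / 2
             + `| (g v + g u) / 2 - (g a + g b) / 2 |)
    * fine (total_variation a b f).
Proof.
have av := le_lt_trans au uv; have ub := lt_le_trans uv vb.
have ab : a <= b := ltW (lt_le_trans av vb).
have [p [n [p_nd n_nd fE <-]]] := bounded_variation_jordan a b f ab f_bv.
have cebysev_jordan alpha beta : a <= alpha -> alpha < beta -> beta <= b ->
    cebysev alpha beta f g = cebysev alpha beta p g - cebysev alpha beta n g.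
  move=> aal albe beb.
  have sub := sub_itv _ _ _ _ aal beb.
  have bm (h : R -> R) : {in `[a, b] &, {homo h : x y / x <= y}} ->
      bounded_measurable alpha beta h.
    move=> h_nd; apply: nondecreasing_bounded_measurable; first exact: ltW.
    by move=> x y /sub xI /sub yI; exact: h_nd.
  rewrite -cebysevB; [|exact: bm..].
  congr (_ - _ * _); apply: eq_mean => t /sub tI /=; first by rewrite fE.
  exact: fE.
rewrite !cebysev_jordan//.
(* The bracket in the statement is the maximum of its two increments of g. *)
set M := (_ / 2 + _).
have gM1 : g v - g a <= M.
  by have := ler_norm ((g v + g u) / 2 - (g a + g b) / 2); rewrite /M; lra.
have gM2 : g b - g u <= M.
  have := ler_norm (- ((g v + g u) / 2 - (g a + g b) / 2)).
  by rewrite normrN /M; lra.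
have := cebysev_diff_nondecreasing a b u v M p g au uv vb gM1 gM2 p_nd g_nd.
have := cebysev_diff_nondecreasing a b u v M n g au uv vb gM1 gM2 n_nd g_nd.
rewrite mulrDr !ler_norml => /andP[? ?] /andP[? ?].
by apply/andP; split; lra.
Qed.
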